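(* In the Fuzzy Clustering problem on networks with a single cluster, there may exist a center located on an edge with objective function value lower than that of the best vertex. That is, there exist a network $\mathbf{G}=(\mathbf{E},\mathbf{V})$ with vertices $v_1,\dots,v_N$ and an interior point $x^*$ of an edge of $\mathbf{G}$ such that, with $f(x)=\sum_{i=1}^N d(v_i,x)^2$ the single-cluster Fuzzy Clustering objective and $v^*\in\mathbf{V}$ a vertex minimizing $f$ over $\mathbf{V}$, $$f(x^* )<f(v^* ).$$
   Context: A network $\mathbf{G}=(\mathbf{E},\mathbf{V})$ is a finite, undirected, connected graph with vertex set $\mathbf{V}=\{v_1,\dots,v_N\}$ and edge set $\mathbf{E}$, in which each edge $e$ has a strictly positive length. Each edge is identified with a segment of its length, so that ''points of $\mathbf{G}$'' means vertices as well as interior points of edges, and $d(\cdot,\cdot)$ is the shortest path distance between points of $\mathbf{G}$. The Fuzzy Clustering problem with $P$ clusters and fuzzifier $m$ minimizes $\sum_{i=1}^N\sum_{k=1}^P p_{ik}^m\,d(v_i,x_k)^2$ over centers $x_k\in\mathbf{G}$ and memberships $p_{ik}\ge 0$ with $\sum_{k=1}^P p_{ik}=1$ for all $i$; for $P=1$ this forces $p_{i1}=1$, so the objective is $\sum_{i=1}^N d(v_i,x)^2$. *)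

(* Defs.v *)
From HB Require Import structures.
From mathcomp Require Import all_boot all_order all_algebra.
From mathcomp Require Import boolp classical_sets reals exp.

Set Implicit Arguments.
Unset Strict Implicit.
Unset Printing Implicit Defensive.

Import Order.TTheory GRing.Theory Num.Theory.

Local Open Scope classical_set_scope.
Local Open Scope ring_scope.

(* Simple networks: the undirected edge {i, j} is stored as the pair (i, j)
   with i < j, so that every edge has exactly one representative. *)
Record network (R : realType) := Network {
  nvertices : nat;
  nvertices_gt0 : (0 < nvertices)%N;
  edges : {set 'I_nvertices * 'I_nvertices};
  edge_ltn : forall e, e \in edges -> (e.1 < e.2)%N;
  network_connected : forall u v : 'I_nvertices,
    connect [rel a b | ((a, b) \in edges) || ((b, a) \in edges)] u v;
  elen : 'I_nvertices * 'I_nvertices -> R;  (* only relevant on edges *)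
  elen_gt0 : forall e, e \in edges -> 0 < elen e }.

(* Interior e t is the point of the open segment e at distance t from the
   endpoint e.1, measured along e. *)
Inductive point (R : realType) (G : network R) : Type :=
| Vertex of 'I_(nvertices G)
| Interior (e : 'I_(nvertices G) * 'I_(nvertices G)) (t : R)
    of e \in edges G & 0 < t < elen e.

Arguments Vertex {R G} _.
Arguments Interior {R G} e t _ _.

(* located e s x: the edge e, identified with the segment [0, elen e], has the
   point x at coordinate s. *)
Inductive located (R : realType) (G : network R)
    (e : 'I_(nvertices G) * 'I_(nvertices G)) : R -> point G -> Prop :=
| located_src of e \in edges G : located e 0 (Vertex e.1)
| located_tgt of e \in edges G : located e (elen e) (Vertex e.2)
| located_int t (he : e \in edges G) (ht : 0 < t < elen e) :
    located e t (Interior e t he ht).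

(* path_length x y l: some path from x to y has length l, a path being a finite
   concatenation of segments, each contained in a single edge. *)
Inductive path_length (R : realType) (G : network R) :
    point G -> point G -> R -> Prop :=
| path_length_nil x : path_length x x 0
| path_length_cons e s t x y z l :
    located e s x -> located e t y -> path_length y z l ->
    path_length x z (`|s - t| + l).

Definition dist (R : realType) (G : network R) (x y : point G) : R :=
  inf [set l | path_length x y l].

Definition is_membership (R : realType) (N P : nat) (p : 'I_N -> 'I_P -> R) :=
  (forall i k, 0 <= p i k) /\ (forall i, \sum_(k < P) p i k = 1).

Definition fuzzy_objective (R : realType) (G : network R) (P : nat) (m : R)
    (x : 'I_P -> point G) (p : 'I_(nvertices G) -> 'I_P -> R) : R :=
  \sum_(i < nvertices G) \sum_(k < P) p i k `^ m * dist (Vertex i) (x k) ^+ 2.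

Definition single_cluster_objective (R : realType) (G : network R)
    (x : point G) : R :=
  \sum_(i < nvertices G) dist (Vertex i) x ^+ 2.

Lemma fuzzy_objective1 (R : realType) (G : network R) (m : R)
    (x : 'I_1 -> point G) (p : 'I_(nvertices G) -> 'I_1 -> R) :
  is_membership p ->
  fuzzy_objective m x p = single_cluster_objective (x ord0).
Proof.
move=> [_ p1]; apply: eq_bigr => i _.
by move: (p1 i); rewrite !big_ord1 => ->; rewrite powR1 mul1r.
Qed.

Definition best_vertex (R : realType) (G : network R) (v : 'I_(nvertices G)) :=
  forall w : 'I_(nvertices G),
    single_cluster_objective (@Vertex R G v) <=
    single_cluster_objective (@Vertex R G w).

(* Main.v *)
Require Import Defs.
From mathcomp Require Import all_boot all_order all_algebra.
From mathcomp Require Import reals.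
From mathcomp Require Import lra.

Import Order.TTheory GRing.Theory Num.Theory.

Local Open Scope ring_scope.

(** On the segment of length 1 with its two endpoints as vertices, distances are
    differences of coordinates, so the objective is [1] at either vertex but
    [1/4 + 1/4] at the midpoint. *)

Section UnitSegment.
Variable R : realType.

(** The map [coord] is an isometry onto [0, 1] ([dist_unit_segment]): no path is shorter than the
    difference of its end coordinates, and a single segment attains it. So the objective at
    coordinate c is c^2 + (1 - c)^2, a strictly convex function with minimum 1/2 at c = 1/2, while
    both vertices tie at 1. *)

Let edge01 : 'I_2 * 'I_2 := (ord0, ord_max).

Let edge01_ltn (e : 'I_2 * 'I_2) : e \in [set edge01] -> (e.1 < e.2)%N.
Proof. by move/set1P->. Qed.

Let edge01_connected (u v : 'I_2) :
  connect [rel a b | ((a, b) \in [set edge01]) ||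
                     ((b, a) \in [set edge01])] u v.
Proof.
have [->|neq_uv] := eqVneq u v; first exact: connect0.
apply: connect1; move: neq_uv; rewrite /= !inE.
by case: u => -[|[|//]] ?; case: v => -[|[|//]] ?.
Qed.

Definition unit_segment : network R :=
  @Network R 2 isT [set edge01] edge01_ltn edge01_connected
    (fun=> 1) (fun _ _ => ltr01).

Definition coord (x : point unit_segment) : R :=
  match x with Vertex i => (i : nat)%:R | Interior _ t _ _ => t end.

(** The only edge runs from vertex 0 to vertex 1 and has length 1, so a vertex index doubles as its
    position on that edge. *)
Lemma located_coord e s x : located e s x -> coord x = s.
Proof. by case=> //= /set1P->. Qed.

Lemma coord_located (x : point unit_segment) :
  located (edge01 : 'I_(nvertices unit_segment) * 'I_(nvertices unit_segment))
    (coord x) x.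
Proof.
have e01 : edge01 \in edges unit_segment by rewrite inE.
case: x => [[[|[|//]] lti]|e t he ht] /=.
- have -> : Ordinal lti = ord0 by apply: val_inj.
  exact: (@located_src R unit_segment edge01 e01).
- have -> : Ordinal lti = ord_max by apply: val_inj.
  exact: (@located_tgt R unit_segment edge01 e01).
- by have e_eq : e = edge01 := set1P he; subst e; apply: located_int.
Qed.

(** Induction on the path: the triangle inequality through the end [y] of its first segment. *)
Lemma path_length_ge (x y : point unit_segment) l :
  path_length x y l -> `|coord x - coord y| <= l.
Proof.
elim=> {x y l} [x|e s t x y z l /located_coord <- /located_coord <- _ le_l].
  by rewrite subrr normr0.
by apply: le_trans (ler_distD (coord y) _ _) _; rewrite lerD2l.
Qed.

Lemma dist_unit_segment (x y : point unit_segment) :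
  dist x y = `|coord x - coord y|.
Proof.
have path_xy : path_length x y `|coord x - coord y|.
  (* One segment of the edge followed by the empty path. *)
  rewrite -[X in path_length _ _ X]addr0.
  by apply: path_length_cons (coord_located x) (coord_located y) _; left.
apply/eqP; rewrite eq_le; apply/andP; split.
(* Both bounds on [inf] need a side condition: here that the set of lengths is bounded below, next
   that it is nonempty. *)
- by apply: ge_inf path_xy; exists `|coord x - coord y| => l /path_length_ge.
- by apply: lb_le_inf => [|l /path_length_ge //]; exists `|coord x - coord y|.
Qed.

Lemma single_cluster_objective_unit_segment (x : point unit_segment) :
  single_cluster_objective x = coord x ^+ 2 + (1 - coord x) ^+ 2.
Proof.
rewrite /single_cluster_objective /= big_ord_recl big_ord1.
by rewrite !dist_unit_segment !real_normK ?num_real //= sub0r sqrrN.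
Qed.

Lemma single_cluster_objective_vertex (v : 'I_(nvertices unit_segment)) :
  single_cluster_objective (Vertex v : point unit_segment) = 1.
Proof.
rewrite single_cluster_objective_unit_segment /=.
by case: v => -[|[|//]] ? /=; lra.
Qed.

End UnitSegment.

Theorem theorem4p6 (R : realType) :
  exists (G : network R) (e : 'I_(nvertices G) * 'I_(nvertices G)) (t : R)
    (he : e \in edges G) (ht : 0 < t < elen e) (vstar : 'I_(nvertices G)),
    best_vertex vstar /\
    single_cluster_objective (Interior e t he ht) <
      single_cluster_objective (@Vertex R G vstar).
Proof.
have he : (ord0, ord_max) \in edges (unit_segment R) by rewrite inE.
have ht : 0 < (2^-1 : R) < @elen R (unit_segment R) (ord0, ord_max).
  by rewrite /=; apply/andP; split; lra.
(* The midpoint minimizes c^2 + (1 - c)^2; either vertex could serve as the best one, since they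
   tie. *)
exists (unit_segment R), (ord0, ord_max), 2^-1, he, ht, ord0; split.
  by move=> w; rewrite !single_cluster_objective_vertex.
rewrite single_cluster_objective_vertex single_cluster_objective_unit_segment /=.
by lra.
Qed.
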